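(* Let $G$ be a connected planar graph (loops and multiple edges allowed) associated to a link shadow $D$, and let $v$ and $e$ denote the number of vertices and edges of $G$, respectively. If $e$ is even and $2(v-1)\neq e$, then $D$ is an $L$-position diagram for the Link Smoothing Game; that is, player $L$ can guarantee a win regardless of whether $L$ moves first or second.
   Context: A link shadow $D$ is a connected link diagram in which under/over information is unspecified at the crossings (called precrossings). Link Smoothing Game on $D$: two players, $K$ (Knot) and $L$ (Link), alternately select a remaining precrossing and replace it by either of its two smoothings (horizontal or vertical), until no precrossings remain. $K$ wins if the final diagram is connected; $L$ wins if it is disconnected (once disconnected, the diagram stays disconnected). Graph of a shadow: checkerboard color the regions of $D$; the (black) graph $G$ has one vertex per black region and one edge per precrossing, joining the black regions meeting there (loops and multi-edges allowed). $G$ is a connected plane graph; the white graph is its planar dual $G^*$. Every connected plane graph arises in this way. Smoothing a precrossing amounts to either deleting the corresponding edge of $G$ (and contracting the dual edge in $G^*$) or contracting it in $G$ (and deleting the dual edge in $G^*$). The shadow is connected if and only if both graphs are connected. Thus, on $G$, players alternately choose a remaining edge and delete or contract it; $L$ wins as soon as a cut edge is deleted or a loop is contracted (the latter deletes a cut edge of the dual), and $K$ wins if all edges are used up without this ever happening. $L$-position means that $L$ has a winning strategy both when moving first and when moving second. *)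

(* Defs.v *)
From mathcomp Require Import all_boot all_fingroup.

Set Implicit Arguments.
Unset Strict Implicit.
Unset Printing Implicit Defensive.

(* A connected link diagram on the sphere with the crossing information        *)
(* forgotten is a connected plane 4-regular multigraph, given here as a        *)
(* combinatorial map.  A dart is an edge with a direction, based at the        *)
(* precrossing it leaves; [opp] reverses a dart and [rot] gives the next dart  *)
(* counterclockwise around the same precrossing.  The region on the left of a  *)
(* dart [d] also fills the corner between [d] and [rot d], and following its   *)
(* boundary takes [d] to [rot^-1 (opp d)].  Genus 0 is Euler's formula.        *)
(* The crossingless circle has no darts and is not represented.  Its graph has *)
(* v = 1 and e = 0, so that 2 (v - 1) = e.                                     *)
Record link_shadow := LinkShadow {
  dart : finType;
  opp : {perm dart};
  rot : {perm dart};
  opp_opp : forall d, opp (opp d) = d;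
  opp_neq : forall d, opp d != d;
  rot_four : forall d, #|porbit rot d| = 4;
  shadow_connected : forall d d',
    connect (fun x y => (y == opp x) || (y == rot x)) d d';
  shadow_planar :
    #|porbits rot| + #|porbits (opp * rot^-1)%g| = #|porbits opp| + 2
}.

Arguments opp {l}.
Arguments rot {l}.

Section Shadow.

Variable D : link_shadow.

Definition precrossings : {set {set dart D}} := porbits rot.
Definition precrossing (d : dart D) : {set dart D} := porbit rot d.
Definition face_perm : {perm dart D} := (opp * rot^-1)%g.
Definition regions : {set {set dart D}} := porbits face_perm.
Definition left_region (d : dart D) : {set dart D} := porbit face_perm d.

Record checkerboard := Checkerboard {
  black : {set {set dart D}};
  black_region : black \subset regions;
  black_alt : forall d,
    (left_region d \in black) (+) (left_region (opp d) \in black)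
}.

Lemma left_region_opp_rot d : left_region (opp (rot d)) = left_region d.
Proof.
have := porbit_perm face_perm 1 (opp (rot d)).
by rewrite expg1 /left_region /face_perm permM opp_opp permK => <-.
Qed.

Lemma black_rot (c : checkerboard) d :
  (left_region (rot d) \in black c) = (left_region d \notin black c).
Proof.
by have := black_alt c (rot d); rewrite left_region_opp_rot; case: (_ \in _);
  case: (_ \in _).
Qed.

End Shadow.

(* The set [ends x] is a singleton when the edge [x] is a loop.                *)
Record multigraph := Multigraph {
  vertex : finType;
  edge : finType;
  ends : edge -> {set vertex};
  ends_card : forall x, 0 < #|ends x| <= 2
}.

Definition multigraph_iso (G H : multigraph) : Prop :=
  exists (f : vertex G -> vertex H) (g : edge G -> edge H),
    [/\ bijective f, bijective g & forall x, ends (g x) = f @: ends x].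

Section CheckerboardGraph.

Variables (D : link_shadow) (c : checkerboard D).

Definition black_vertex : finType := {r : {set dart D} | r \in black c}.
Definition precrossing_edge : finType :=
  {x : {set dart D} | x \in precrossings D}.

Definition black_ends (x : precrossing_edge) : {set black_vertex} :=
  [set r : black_vertex | [exists d in val x, left_region d == val r]].

Lemma mem_precrossing (d d' : dart D) :
  (d' \in precrossing d) =
  (d' \in [:: d; rot d; rot (rot d); rot (rot (rot d))]).
Proof. by rewrite /precrossing porbit_traject rot_four. Qed.

Lemma precrossing_black (x : precrossing_edge) :
  exists2 d, val x = precrossing d & left_region d \in black c.
Proof.
case/imsetP: (valP x) => d0 _ x_d0.
have [b|nb] := boolP (left_region d0 \in black c); first by exists d0.
exists (rot d0); last by rewrite black_rot.
by rewrite x_d0 /precrossing -(porbit_perm rot 1 d0) expg1.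
Qed.

Lemma black_endsP (x : precrossing_edge) d (r : black_vertex) :
  val x = precrossing d -> left_region d \in black c ->
  (r \in black_ends x) =
  (val r == left_region d) || (val r == left_region (rot (rot d))).
Proof.
move=> x_d bd; rewrite inE x_d; apply/existsP/orP => [[d'] | r_d].
  rewrite mem_precrossing !inE => /andP[/or4P[]/eqP-> /eqP r_d].
  - by left; rewrite r_d.
  - by have := valP r; rewrite -r_d black_rot bd.
  - by right; rewrite r_d.
  - by have := valP r; rewrite -r_d !black_rot bd.
case: r_d => /eqP->; [exists d | exists (rot (rot d))];
  by rewrite mem_precrossing !inE !eqxx ?orbT.
Qed.

Lemma black_ends_card x : 0 < #|black_ends x| <= 2.
Proof.
have [d x_d bd] := precrossing_black x.
have bd2 : left_region (rot (rot d)) \in black c by rewrite !black_rot bd.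
pose r1 : black_vertex := exist (fun r => is_true (r \in black c)) _ bd.
pose r2 : black_vertex := exist (fun r => is_true (r \in black c)) _ bd2.
have -> : black_ends x = [set r1; r2].
  by apply/setP=> r; rewrite (black_endsP r x_d bd) !inE -!val_eqE.
by rewrite cards2; case: (_ != _).
Qed.

Definition checkerboard_graph : multigraph :=
  @Multigraph black_vertex precrossing_edge black_ends black_ends_card.

End CheckerboardGraph.

(* Such a [G] is connected and planar because [D] is.  Both checkerboard       *)
(* graphs of [D], dual to each other, are allowed.                             *)
Definition associated_graph (D : link_shadow) (G : multigraph) : Prop :=
  exists c : checkerboard D, multigraph_iso G (checkerboard_graph c).

Inductive player := Knot | Link.

Definition opponent (p : player) : player :=
  if p is Knot then Link else Knot.

Section SmoothingGame.

Variable D : link_shadow.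

(* The move [d] smooths the precrossing of [d] by joining [d] to [rot d] and   *)
(* [rot (rot d)] to [rot (rot (rot d))].  The moves [d] and [rot (rot d)] are  *)
(* the same smoothing, and [rot d] is the other smoothing of this precrossing. *)
(* A history lists the moves made so far, the oldest first.                    *)
Definition history : Type := seq (dart D).

Definition legal (h : history) : bool := uniq [seq precrossing d | d <- h].

Definition remaining (h : history) : {set {set dart D}} :=
  precrossings D :\: [set x in [seq precrossing d | d <- h]].

Definition complete (h : history) : bool := legal h && (remaining h == set0).

Definition joined (h : history) (d d' : dart D) : bool :=
  [exists m in h, (d \in [:: m; rot (rot m)]) && (d' == rot d)].

(* The edges of [D] are never cut, so the components of a partially smoothed   *)
(* diagram are classes of darts; a remaining precrossing links its four darts. *)
Definition linked (h : history) (d d' : dart D) : bool :=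
  [|| d' == opp d, joined h d d', joined h d' d |
      (precrossing d \in remaining h) && (d' \in precrossing d)].

Definition diagram_connected (h : history) : bool :=
  [forall d, forall d', connect (linked h) d d'].

Definition winner (h : history) : player :=
  if diagram_connected h then Knot else Link.

Definition to_move (first : player) (h : history) : player :=
  if odd (size h) then opponent first else first.

Definition strategy : Type := history -> dart D.

Definition follows (first p : player) (f : strategy) (h : history) : Prop :=
  forall h1 d h2, h = h1 ++ d :: h2 -> to_move first h1 = p -> d = f h1.

Definition winning_strategy (first p : player) (f : strategy) : Prop :=
  (forall h, legal h -> follows first p f h -> ~~ complete h ->
     to_move first h = p -> legal (rcons h (f h))) /\
  (forall h, complete h -> follows first p f h -> winner h = p).

Definition L_position : Prop :=
  (exists f, winning_strategy Link Link f) /\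
  (exists f, winning_strategy Knot Link f).

End SmoothingGame.

(* Main.v *)
Require Import Defs.
From mathcomp Require Import all_boot.
From mathcomp Require Import all_fingroup zify.

Set Implicit Arguments.
Unset Strict Implicit.
Unset Printing Implicit Defensive.

(* The imports make [rot] mean rotation of sequences. *)
Local Notation rot := Defs.rot.

(** Every smoothing hugs either two black or two white corners of its
precrossing; the second kind merges the two black regions there.  Black regions
that lie along the same component of the final diagram are connected by such
merges, so if that diagram is connected, there are at least v - 1 smoothings of
the second kind.  Exchanging the colours and applying Euler's formula shows that
there are exactly v - 1.  Since e is even, Link makes exactly e / 2 moves,
whoever starts.  By always merging black regions if 2 (v - 1) < e, and never
doing so if 2 (v - 1) > e, Link makes the number of merges differ from v - 1. *)

(** Identifying one more pair collapses at most two values of [f] into one, so each pair costs at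
    most one element of the image. When the image is a single point, this is the bound that
    connecting n vertices takes n - 1 edges. *)
Lemma quotient_by_pairs (T : finType) (s : seq (T * T)) (A : {set T}) :
  exists2 f : T -> T,
    {in s, forall p, f p.1 = f p.2} & #|A| <= #|f @: A| + size s.
Proof.
elim: s => [|[x y] s [f f_s leA]]; first by exists id; rewrite // imset_id addn0.
pose g z := if z == f x then f y else z.
exists (g \o f) => [p|].
  rewrite inE => /predU1P[-> /=|/f_s/= -> //].
  by rewrite /g eqxx; case: eqP.
have sub : f @: A \subset f x |: (g \o f) @: A.
  apply/subsetP=> _ /imsetP[a aA ->]; rewrite in_setU1.
  have [//|ne] /= := eqVneq (f a) (f x).
  by apply/imsetP; exists a; rewrite //= /g (negPf ne).
have := leq_trans (subset_leq_card sub) (leq_of_leqif (leq_card_setU _ _)).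
by rewrite cards1 /= addnS; lia.
Qed.

Lemma card_porbits_uniform (T : finType) (s : {perm T}) (k : nat) :
  (forall x, #|porbit s x| = k) -> #|T| = #|porbits s| * k.
Proof.
move=> sk; rewrite -cardsT.
apply: card_uniform_partition => [_ /imsetP[x _ ->] //|].
have /orbit_partition : [acts <[s]>%g, on [set: T] | 'P].
  by apply/actsP=> a _ x; rewrite !inE.
congr partition; apply/setP=> A.
by apply/imsetP/imsetP=> -[x _ ->]; exists x; rewrite ?inE // porbitE.
Qed.

Section Diagram.

Variable D : link_shadow.
Implicit Types (c : checkerboard D) (h : history D) (d : dart D).

(** Darts come in pairs along edges and in fours around precrossings, so there are twice as many
    edges as precrossings; Euler's formula does the rest. *)
Lemma card_regions : #|regions D| = #|precrossings D| + 2.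
Proof.
have two d : #|porbit opp d| = 2.
  have -> : porbit opp d = [set d; opp d].
    apply/eqP; rewrite eqEsubset subUset !sub1set porbit_id.
    rewrite -{3}[opp]expg1 mem_porbit /= andbT.
    apply/subsetP=> _ /porbitP[i ->]; rewrite permX !inE.
    by elim: i => [|i /orP[]/eqP d_i] /=; rewrite ?d_i ?opp_opp eqxx ?orbT.
  by rewrite cards2 eq_sym opp_neq.
have := shadow_planar D; have := card_porbits_uniform two.
have := card_porbits_uniform (@rot_four D).
rewrite /regions /precrossings /face_perm /reverse_coercion; lia.
Qed.

Lemma white_alt c d :
  (left_region d \in regions D :\: black c) (+)
  (left_region (opp d) \in regions D :\: black c).
Proof.
rewrite !inE !imset_f // !andbT.
by have := black_alt c d; case: (_ \in _); case: (_ \in _).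
Qed.

Definition swap_colours c : checkerboard D :=
  Checkerboard (subsetDl _ _) (white_alt c).

Lemma card_black_white c :
  #|black c| + #|black (swap_colours c)| = #|precrossings D| + 2.
Proof.
rewrite -card_regions -(cardsID (black c) (regions D)).
by rewrite (setIidPr (black_region c)).
Qed.

(** This depends only on the edge carrying [d], so along a component it can change only at a
    precrossing. *)
Definition black_side c d :=
  if left_region d \in black c then left_region d else left_region (opp d).

Lemma black_side_opp c d : black_side c (opp d) = black_side c d.
Proof.
rewrite /black_side opp_opp; have := black_alt c d.
by case: (left_region d \in _); case: (left_region (opp d) \in _).
Qed.

Lemma rot4 d : rot (rot (rot (rot d))) = d.
Proof. by have := iter_porbit rot d; rewrite rot_four. Qed.

Lemma card_black_le c h : complete h -> diagram_connected h ->
  #|black c| <= (count (fun d => left_region d \notin black c) h).+1.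
Proof.
move=> /andP[_ /eqP rem0] /forallP conn.
(* The strands of the move [d] hug the corners to the left of [d] and of [rot (rot d)]; the regions
   at the other two corners flow together. *)
pose merged d := (left_region (rot d), left_region (rot (rot (rot d)))).
pose s := [seq merged d | d <- h & left_region d \notin black c].
have [f f_s le_f] := quotient_by_pairs s (black c).
have f_joined d d' : joined h d d' -> f (black_side c d) = f (black_side c d').
  case/exists_inP=> m mh /andP[dm /eqP->].
  (* A strand hugging a black corner keeps the same black region beside it; one hugging a white
     corner passes between the two members of a merged pair. *)
  have [mb|mw] := boolP (left_region m \in black c).
    have db : left_region d \in black c.
      by move: dm; rewrite !inE => /orP[]/eqP->; rewrite ?black_rot ?mb.
    by rewrite /black_side black_rot db left_region_opp_rot.
  have /f_s /= fm : merged m \in s by apply: map_f; rewrite mem_filter mw.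
  have dw : left_region d \notin black c.
    by move: dm; rewrite !inE => /orP[]/eqP->; rewrite ?black_rot ?negbK.
  rewrite /black_side black_rot dw (negPf dw).
  move: dm; rewrite !inE => /orP[]/eqP->; last by rewrite left_region_opp_rot.
  by rewrite -{1}(rot4 m) left_region_opp_rot fm.
have f_linked d d' : connect (linked h) d d' ->
    f (black_side c d) = f (black_side c d').
  case/connectP=> p hp ->; elim: p d hp => //= x p IHp d /andP[dx /IHp <-].
  case/or4P: dx => [/eqP->|/f_joined->|/f_joined->|] //.
    by rewrite black_side_opp.
  by rewrite rem0 inE.
have f_const : #|f @: black c| <= 1.
  apply/card_le1_eqP => _ _ /imsetP[r rb ->] /imsetP[r' rb' ->].
  have [/imsetP[d _ rd] /imsetP[d' _ rd']] :
    r \in regions D /\ r' \in regions D.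
    by split; apply: (subsetP (black_region c)).
  have := f_linked d d' (forallP (conn d) d').
  by rewrite /black_side /left_region -rd -rd' rb rb'.
by apply: leq_trans le_f _; rewrite size_map size_filter -add1n leq_add2r.
Qed.

Lemma size_complete h : complete h -> size h = #|precrossings D|.
Proof.
case/andP=> uh /eqP/setP rem0; rewrite -(size_map (@precrossing D)).
rewrite -(card_uniqP uh); apply: eq_card => x; apply/mapP/idP => [[d _ ->]|xD].
  exact: imset_f.
by have := rem0 x; rewrite !inE xD andbT => /negbFE/mapP.
Qed.

Lemma count_corners c h :
  count (fun d => left_region d \in black c) h +
  count (fun d => left_region d \notin black c) h = size h.
Proof. exact: count_predC. Qed.

(** With m merges in n moves, b black and w white regions, the bound for both colourings gives b <=
    m + 1 and w <= n - m + 1. Since b + w = n + 2, both are equalities. *)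
Lemma count_merges c h : complete h -> diagram_connected h ->
  (count (fun d => left_region d \notin black c) h).+1 = #|black c|.
Proof.
move=> ch dh; have := card_black_le c ch dh.
have := card_black_le (swap_colours c) ch dh.
have -> : count (fun d => left_region d \notin black (swap_colours c)) h =
          count (fun d => left_region d \in black c) h.
  by apply: eq_count => d; rewrite !inE imset_f // andbT negbK.
have := card_black_white c; have := size_complete ch.
have := count_corners c h; rewrite /reverse_coercion /=; lia.
Qed.

Section MonochromeStrategy.

Variables (P : pred (dart D)) (d0 : dart D).
Hypothesis P_rot : forall d, P d || P (rot d).

Definition always : strategy D :=
  fun h => odflt d0 [pick d | P d && legal (rcons h d)].

(** The two smoothings of a precrossing are [d] and [rot d], so [P_rot] offers a move in [P] at any
    remaining one, and the default [d0] is not reached. *)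
Lemma alwaysP h : legal h -> ~~ complete h ->
  P (always h) && legal (rcons h (always h)).
Proof.
rewrite /complete => lh; rewrite lh /= => /set0Pn[x].
rewrite !inE => /andP[xh /imsetP[d _ xd]].
rewrite /always; case: pickP => //= none.
have legal_rcons d' : precrossing d' = x -> legal (rcons h d').
  by move=> d'x; rewrite /legal map_rcons rcons_uniq d'x xh.
case/orP: (P_rot d) => Pd.
  by have := none d; rewrite Pd legal_rcons.
have := none (rot d); rewrite Pd legal_rcons //.
by rewrite xd /precrossing -(porbit_perm rot 1 d) expg1.
Qed.

(** The left side is the exact number of moves made by Link: half the length, rounded up if Link
    starts and down otherwise. *)
Lemma count_Link_moves first h :
  (forall h1 d h2, h = h1 ++ d :: h2 -> to_move first h1 = Link -> P d) ->
  (size h + (if first is Link then 1 else 0))./2 <= count P h.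
Proof.
(* Turns depend on the length of the prefix, so appending a move at the end leaves the earlier turns
   unchanged. *)
elim/last_ind: h => [|h d IHh] moves; first by case: first moves.
have {}IHh : (size h + (if first is Link then 1 else 0))./2 <= count P h.
  by apply: IHh => h1 d1 h2 h_eq; apply: (moves h1 d1 (rcons h2 d));
    rewrite h_eq rcons_cat.
have := moves h d [::]; rewrite cats1 => /(_ erefl); move: IHh.
rewrite /to_move -cats1 size_cat count_cat /= !addn0.
case: first {moves} => /=; case: (boolP (odd (size h))) => /= odd_h le_h Pd;
  move: le_h; try rewrite (Pd erefl); lia.
Qed.

Lemma always_count first h : complete h -> follows first Link always h ->
  (size h)./2 <= count P h.
Proof.
move=> /andP[lh _] fh.
apply: leq_trans (half_leq (leq_addr _ _)) (count_Link_moves (first := first) _).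
move=> h1 d h2 h_eq turn; rewrite (fh _ _ _ h_eq turn).
move: lh; rewrite h_eq /legal map_cat cat_uniq /= => /and3P[lh1 + _].
rewrite negb_or => /andP[d_h1 _].
(* Since [h] is legal, the precrossing of [d] still remains after [h1]. *)
suff /(alwaysP lh1)/andP[] : ~~ complete h1 by [].
rewrite /complete negb_and; apply/orP; right; apply/set0Pn.
by exists (precrossing d); rewrite !inE d_h1 imset_f.
Qed.

Lemma always_wins :
  (forall h, complete h -> (size h)./2 <= count P h -> ~~ diagram_connected h) ->
  L_position D.
Proof.
move=> disconnected; have wins first : winning_strategy first Link always.
  split=> [h lh _ nch _|h ch fh]; first by case/andP: (alwaysP lh nch).
  by rewrite /winner (negPf (disconnected h ch (always_count ch fh))).
by split; exists always.
Qed.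

End MonochromeStrategy.

(** Euler's formula yields at least two regions, and each is an orbit of darts. This supplies the
    default move of the strategy. *)
Lemma dart_inhabited : exists d : dart D, true.
Proof.
have [d _|none] := pickP (@predT (dart D)); first by exists d.
have : #|regions D| = 0.
  by apply: eq_card0 => x; apply/negP => /imsetP[d]; have := none d.
by rewrite card_regions addn2.
Qed.

End Diagram.

Theorem theorem6 (D : link_shadow) (G : multigraph) (v e : nat)
  (G_D : associated_graph D G)
  (v_def : v = #|vertex G|) (e_def : e = #|edge G|)
  (e_even : ~~ odd e) (v_e : 2 * (v - 1) <> e) :
  L_position D.
Proof.
case: G_D => c [f [g [bij_f bij_g _]]].
have {}v_def : v = #|black c| by rewrite v_def (bij_eq_card bij_f) card_sig.
have {}e_def : e = #|precrossings D| by rewrite e_def (bij_eq_card bij_g) card_sig.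
have [d0 _] := dart_inhabited D.
have [lt|ge] := ltnP (2 * (v - 1)) e.
  (* Link alone makes e / 2 > v - 1 merges. *)
  pose P d := left_region d \notin black c.
  apply: (@always_wins _ P d0) => [d|h ch le_h].
    by rewrite /P black_rot; case: (_ \in _).
  apply/negP => /(count_merges c ch); move: le_h (size_complete ch).
  by rewrite /P; lia.
(* Here e / 2 < v - 1, and only Knot's e / 2 moves can be merges. *)
pose P d := left_region d \in black c.
apply: (@always_wins _ P d0) => [d|h ch le_h].
  by rewrite /P black_rot; case: (_ \in _).
apply/negP => /(count_merges c ch); move: le_h (size_complete ch).
by have := count_corners c h; rewrite /P; lia.
Qed.
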